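(* Let $L,M,N\in\mathbb{R}_{\ge0}$, $T\in\mathbb{R}_{>0}$, $k,m\in\mathbb{N}$, $k\le m$, and consider a causal differentiator $\mathcal{D}$ of order $m$. Suppose that $\mathcal{D}$ is exact in finite time over $\mathcal{F}_M^m$. Then its worst-case error satisfies a) $M_{N,k}^{\mathcal{F}_{L,\mathbf{R}}^m}(t)\ge\lim_{\tau\to\infty}\bar g_{N,k}^{m,L+M}(\tau)$ for all $\mathbf{R}\in\mathbb{R}_{\ge0}^{m+1}$ and $t\in\mathbb{R}_{\ge0}$. If $\mathcal{D}$ is additionally exact from the beginning over $\mathcal{F}_M^m$, then b) $M_{N,k}^{\mathcal{F}_{L,\mathbf{R}}^m}(t)\ge\bar g_{N,k}^{m,L+M}(t)$ for each $\theta\in\mathbb{R}_{>0}$, all $\mathbf{R}\in\mathbb{R}_{\ge0}^{m+1}$ with $\mathbf{R}\ge\big(N,\bar g_{N,1}^{m,L+M}(\theta),\dots,\bar g_{N,m}^{m,L+M}(\theta)\big)$ componentwise, and all $t\ge\theta$; c) $M_{N,k}^{\mathcal{F}_L^m}(t)\ge\bar g_{N,k}^{m,L+M}(t)$ for all $t\in\mathbb{R}_{>0}$.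
   Context: For $m\in\mathbb{N}_0$ and $L,N\ge 0$: $\mathcal{F}^m$ is the set of functions $f:\mathbb{R}_{\ge 0}\to\mathbb{R}$ that are $m$ times continuously differentiable with $f^{(m)}$ Lipschitz continuous; $\mathcal{F}_L^m=\{f\in\mathcal{F}^m: |f^{(m+1)}(t)|\le L\text{ a.e. on }\mathbb{R}_{\ge0}\}$; $\mathcal{E}_N=\{\eta:\mathbb{R}_{\ge0}\to\mathbb{R}: |\eta(t)|\le N\text{ for all }t\ge0\}$; $\mathcal{F}_L^m+\mathcal{E}_N=\{f+\eta: f\in\mathcal{F}_L^m,\eta\in\mathcal{E}_N\}$; and $\mathcal{U}=\bigcup_{m\in\mathbb{N}_0,\,L,N\ge0}(\mathcal{F}_L^m+\mathcal{E}_N)$. For $\mathbf{R}=(R_0,\dots,R_m)\in\mathbb{R}_{\ge0}^{m+1}$, $\mathcal{F}_{L,\mathbf{R}}^m=\{f\in\mathcal{F}_L^m:|f^{(i)}(0)|\le R_i,\ i=0,\dots,m\}$. Here $f^{(0)}=f$ and derivatives at $0$ are one-sided. A differentiator of order $m$ is an operator $\mathcal{D}:\mathcal{U}\to(\mathbb{R}_{\ge0}\to\mathbb{R}^m)$, with components $\mathcal{D}_1,\dots,\mathcal{D}_m$. It is causal if for all $t\ge0$, $[\mathcal{D}u_1](t)=[\mathcal{D}u_2](t)$ whenever $u_1=u_2$ on $[0,t]$. Worst-case error over a signal class $\mathcal{S}\subseteq\mathcal{F}^m$: $M_{N,i}^{\mathcal{S}}(t)=\sup_{f\in\mathcal{S},\,\eta\in\mathcal{E}_N}\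 \sup_{\tau\ge t}|f^{(i)}(\tau)-[\mathcal{D}_i(f+\eta)](\tau)|\in[0,\infty]$. Exactness: $\mathcal{D}$ is exact from the beginning over $\mathcal{F}_M^m$ if $M_{0,i}^{\mathcal{F}_M^m}(t)=0$ for all $t>0$ and $i=1,\dots,m$; it is exact in finite time over $\mathcal{F}_M^m$ if for every $\mathbf{R}\in\mathbb{R}_{\ge0}^{m+1}$ there exists $t_{\mathbf{R}}>0$ such that $M_{0,i}^{\mathcal{F}_{M,\mathbf{R}}^m}(t_{\mathbf{R}})=0$ for $i=1,\dots,m$. For $T>0$, $\mathcal{G}^m_{L,N}(T)=\{g\in\mathcal{F}_L^m:|g(t)|\le N\text{ for all }t\in[0,T]\}$ and $\bar g^{m,L}_{N,k}(T)=\sup\{g^{(k)}(T):g\in\mathcal{G}^m_{L,N}(T)\}$. *)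

(* Defs.v *)
From HB Require Import structures.
From mathcomp Require Import all_boot all_order all_algebra.
From mathcomp Require Import all_classical all_reals all_analysis.

Set Implicit Arguments.
Unset Strict Implicit.
Unset Printing Implicit Defensive.

Import Order.TTheory GRing.Theory Num.Theory.
Import numFieldNormedType.Exports.

Local Open Scope classical_set_scope.
Local Open Scope ring_scope.

(* A signal R_{>=0} -> R is encoded by a function R -> R of which only the
   values on [0, +oo[ are meant.  No definition below depends on the values of a
   signal, or of the output of a differentiator, at negative times; for the
   input of a differentiator this is ensured by causality. *)
Definition signal (R : realType) := R -> R.

Definition halfline (R : realType) : set R := `[0, +oo[.
Arguments halfline {R}.

(* The limit is taken along s -> t with s != t and s >= 0: this is the usual
   derivative when t > 0 and the right derivative when t = 0. *)
Definition hderivable (R : realType) (f : signal R) (t : R) : Prop :=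
  cvg ((f s - f t) / (s - t) @[s --> within halfline t^']).

Definition hderive (R : realType) (f : signal R) (t : R) : R :=
  lim ((f s - f t) / (s - t) @[s --> within halfline t^']).

Definition hderiven (R : realType) (i : nat) (f : signal R) : signal R :=
  iter i (@hderive R) f.

(* $\mathcal{F}^m$ *)
Definition Fcal (R : realType) (m : nat) : set (signal R) :=
  [set f | [/\ forall i, (i < m)%N -> {in halfline, forall t, hderivable (hderiven i f) t},
               forall i, (i <= m)%N -> {within halfline, continuous (hderiven i f)}
             & [lipschitz (hderiven m f) t | t in halfline] ] ].

(* $\mathcal{F}_L^m$; the almost everywhere existence of $f^{(m+1)}$ is stated,
   because [hderive] has an arbitrary value where the limit does not exist. *)
Definition FcalL (R : realType) (m : nat) (L : R) : set (signal R) :=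
  [set f | Fcal m f /\
     \forall t \ae (@lebesgue_measure R), halfline t ->
       hderivable (hderiven m f) t /\ `|hderiven m.+1 f t| <= L].

(* $\mathcal{F}_{L,\mathbf{R}}^m$ *)
Definition FcalLR (R : realType) (m : nat) (L : R) (r : 'rV[R]_m.+1) :
    set (signal R) :=
  [set f | FcalL m L f /\ forall i : 'I_m.+1, `|hderiven i f 0| <= r ord0 i].

(* $\mathcal{E}_N$ *)
Definition Ecal (R : realType) (N : R) : set (signal R) :=
  [set eta | forall t, 0 <= t -> `|eta t| <= N].

(* $\mathcal{U}$ *)
Definition Ucal (R : realType) : set (signal R) :=
  [set u | exists (m : nat) (L N : R) (f eta : signal R),
     [/\ 0 <= L, 0 <= N, FcalL m L f, Ecal N eta
       & forall t, 0 <= t -> u t = f t + eta t] ].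

(* A differentiator is a total function here, but only its restriction to
   [Ucal] is ever used.  Column [i : 'I_m] (counted from 0) of the output is the
   component $\mathcal{D}_{i+1}$, which estimates $f^{(i+1)}$. *)
Definition differentiator (R : realType) (m : nat) :=
  signal R -> R -> 'rV[R]_m.

Definition causal (R : realType) (m : nat) (D : differentiator R m) : Prop :=
  forall (u1 u2 : signal R) (t : R), Ucal u1 -> Ucal u2 -> 0 <= t ->
    (forall s, 0 <= s <= t -> u1 s = u2 s) -> D u1 t = D u2 t.

(* $M_{N,i+1}^{\mathcal{S}}(t)$ *)
Definition worst_case_error (R : realType) (m : nat) (D : differentiator R m)
    (S : set (signal R)) (N : R) (i : 'I_m) (t : R) : \bar R :=
  ereal_sup [set ereal_sup [set (`|hderiven i.+1 p.1 tau
                                   - D (p.1 \+ p.2) tau ord0 i|)%:E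
                           | tau in `[t, +oo[%classic]
            | p in S `*` Ecal N].

Definition exact_from_beginning (R : realType) (m : nat)
    (D : differentiator R m) (M : R) : Prop :=
  forall (t : R) (i : 'I_m), 0 < t ->
    worst_case_error D (FcalL m M) 0 i t = 0%E.

Definition exact_in_finite_time (R : realType) (m : nat)
    (D : differentiator R m) (M : R) : Prop :=
  forall r : 'rV[R]_m.+1, (forall i, 0 <= r ord0 i) ->
    exists2 t : R, 0 < t &
      forall i : 'I_m, worst_case_error D (FcalLR M r) 0 i t = 0%E.

(* $\mathcal{G}^m_{L,N}(T)$ *)
Definition Gcal (R : realType) (m : nat) (L N T : R) : set (signal R) :=
  [set g | FcalL m L g /\ forall t, 0 <= t <= T -> `|g t| <= N].

(* $\bar g^{m,L}_{N,k}(T)$ *)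
Definition gbar (R : realType) (m : nat) (L N : R) (k : nat) (T : R) : \bar R :=
  ereal_sup [set (hderiven k g T)%:E | g in Gcal m L N T].

(* Main.v *)
Require Import Defs.
From HB Require Import structures.
From mathcomp Require Import all_boot all_order all_algebra.
From mathcomp Require Import all_classical all_reals all_analysis.
From mathcomp Require Import measurable_realfun ring lra.

Set Implicit Arguments.
Unset Strict Implicit.
Unset Printing Implicit Defensive.

Import Order.TTheory GRing.Theory Num.Theory.
Import numFieldNormedType.Exports.

Local Open Scope classical_set_scope.
Local Open Scope ring_scope.

(* Let g have (m+1)-st derivative bounded by L + M and |g| <= N on [0, tau].
   Write L = c (L + M) and M = (1 - c) (L + M).  On [0, tau] the signal c g
   with noise - g is the noise-free signal (c - 1) g, which lies in F_M^m, so
   a causal and exact D returns (c - 1) g^(k) at tau, whereas it should return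
   c g^(k): the error is g^(k)(tau).  This gives c).  For b), g is run backwards
   from theta and continued by a Taylor polynomial, which bounds |g^(i)(0)| by
   the supremum at theta.  For a), g is multiplied by (t / tau)^(m+1): all
   derivatives then vanish at 0, so that a single transient time of D serves for
   all g, while the bound L + M and the value g^(k)(tau) change by O(1 / tau)
   only, as the derivatives of g are bounded uniformly in tau.  Rescaling
   restores the bound L + M, except if L + M = 0, when the limit is 0. *)

(** * Derivatives within a set *)

Section DerivativeWithin.
Context {R : realType}.
Implicit Types (A B : set R) (f g : R -> R) (t d : R).

(** The little-o form of differentiability relative to [A]: free of quotients, and vacuous where [A]
    does not accumulate at [t], so that derivatives on two pieces can be glued. *)
Definition dwithin A f t d := forall e, 0 < e ->
  \forall s \near t, A s -> `|f s - f t - d * (s - t)| <= e * `|s - t|.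

Lemma dwithin_near A B f g t d :
  (\forall s \near t, B s -> A s /\ f s = g s) -> f t = g t ->
  dwithin A f t d -> dwithin B g t d.
Proof.
move=> BA ft fd e e0; near=> s => Bs.
have [As <-] : A s /\ f s = g s by move: Bs; near: s.
by rewrite -ft; move: As; near: s; exact: fd.
Unshelve. all: by end_near. Qed.

Lemma sub_dwithin A B f t d : B `<=` A -> dwithin A f t d -> dwithin B f t d.
Proof.
move=> BA fd; apply: dwithin_near fd => //.
by apply: (@filterE _ (nbhs t)) => s /BA As; split.
Qed.

Lemma dwithin_setU A B f t d :
  dwithin A f t d -> dwithin B f t d -> dwithin (A `|` B) f t d.
Proof.
move=> fA fB e e0; near=> s; move=> [As|Bs].
  by move: As; near: s; exact: fA.
by move: Bs; near: s; exact: fB.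
Unshelve. all: by end_near. Qed.

Lemma dwithin_cst A c t : dwithin A (fun=> c) t 0.
Proof.
move=> e e0; apply: (@filterE _ (nbhs t)) => s _.
by rewrite subrr mul0r subrr normr0 mulr_ge0// ltW.
Qed.

Lemma dwithinD A f g t d d' : dwithin A f t d -> dwithin A g t d' ->
  dwithin A (fun s => f s + g s) t (d + d').
Proof.
move=> fd gd e e0; have e20 : 0 < e / 2 by rewrite divr_gt0.
near=> s => As.
have -> : f s + g s - (f t + g t) - (d + d') * (s - t) =
  (f s - f t - d * (s - t)) + (g s - g t - d' * (s - t)) by ring.
rewrite (splitr e) [leRHS]mulrDl (le_trans (ler_normD _ _))// lerD//.
  by move: As; near: s; exact: fd.
by move: As; near: s; exact: gd.
Unshelve. all: by end_near. Qed.

Lemma dwithinZ A f c t d : dwithin A f t d ->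
  dwithin A (fun s => c * f s) t (c * d).
Proof.
move=> fd e e0; have c1 : 0 < `|c| + 1 by rewrite ltr_wpDl.
have e0' : 0 < e / (`|c| + 1) by rewrite divr_gt0.
near=> s => As.
have -> : c * f s - c * f t - c * d * (s - t) = c * (f s - f t - d * (s - t)).
  by ring.
rewrite normrM.
have : `|f s - f t - d * (s - t)| <= e / (`|c| + 1) * `|s - t|.
  by move: As; near: s; exact: fd.
move=> /(ler_wpM2l (normr_ge0 c))/le_trans; apply.
rewrite mulrA ler_wpM2r// mulrCA ler_piMr ?ltW// ltr_pdivrMr// mul1r.
by rewrite ltrDl.
Unshelve. all: by end_near. Qed.

Lemma dwithin_continuous A f t d : dwithin A f t d ->
  forall e, 0 < e -> \forall s \near t, A s -> `|f s - f t| <= e.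
Proof.
move=> fd e e0; have d1 : 0 < `|d| + 1 by rewrite ltr_wpDl.
have e0' : 0 < e / (`|d| + 1) by rewrite divr_gt0.
near=> s => As.
have : `|f s - f t - d * (s - t)| <= 1 * `|s - t|.
  by move: As; near: s; exact: fd.
rewrite mul1r => H.
have -> : f s - f t = (f s - f t - d * (s - t)) + d * (s - t) by ring.
rewrite (le_trans (ler_normD _ _))// normrM.
have -> : e = (`|d| + 1) * (e / (`|d| + 1)).
  by rewrite mulrC divfK// gt_eqF.
rewrite (@le_trans _ _ ((`|d| + 1) * `|s - t|))//.
  by rewrite mulrDl mul1r addrC lerD2l.
have : ball t (e / (`|d| + 1)) s by near: s; exact: nbhsx_ballx.
by rewrite /ball/= distrC => /ltW; apply: ler_wpM2l; apply: ltW.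
Unshelve. all: by end_near. Qed.

Lemma dwithin_idM A f t d : dwithin A f t d ->
  dwithin A (fun s => s * f s) t (f t + t * d).
Proof.
move=> fd e e0; have e20 : 0 < e / 2 by rewrite divr_gt0.
have td := dwithinZ t fd.
near=> s => As.
have -> : s * f s - t * f t - (f t + t * d) * (s - t) =
  (t * f s - t * f t - t * d * (s - t)) + (f s - f t) * (s - t) by ring.
rewrite (splitr e) [leRHS]mulrDl (le_trans (ler_normD _ _))// lerD//.
  by move: As; near: s; exact: td.
rewrite normrM ler_wpM2r//.
by move: As; near: s; exact: (dwithin_continuous fd).
Unshelve. all: by end_near. Qed.

Lemma dwithin_comp_reflect A f a t d : dwithin A f (a - t) d ->
  dwithin [set s | A (a - s)] (fun s => f (a - s)) t (- d).
Proof.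
move=> fd e e0; have /nbhs_ballP[r/= r0 H] := fd _ e0.
apply/nbhs_ballP; exists r => //= s ts As.
have -> : f (a - s) - f (a - t) - - d * (s - t) =
   f (a - s) - f (a - t) - d * ((a - s) - (a - t)) by ring.
have -> : `|s - t| = `|(a - s) - (a - t)|.
  by rewrite distrC; congr `|_|; ring.
apply: H => //; move: ts; rewrite /ball/= distrC.
by have -> : a - t - (a - s) = s - t by ring.
Qed.

Lemma dwithin_comp_sub f a t d : dwithin setT f (t - a) d ->
  dwithin setT (fun s => f (s - a)) t d.
Proof.
move=> fd e e0; have /nbhs_ballP[r/= r0 H] := fd _ e0.
apply/nbhs_ballP; exists r => //= s ts _.
have -> : s - t = (s - a) - (t - a) by ring.
apply: H => //; move: ts; rewrite /ball/=.
by have -> : t - a - (s - a) = t - s by ring.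
Qed.

Lemma dwithin_horner A (p : {poly R}) t : dwithin A (horner p) t p^`().[t].
Proof.
elim/poly_ind: p => [|p c IH].
  rewrite deriv0 horner0; have := dwithin_cst A 0 t.
  by apply: dwithin_near; [apply: (@filterE _ (nbhs t)) => s As|]; rewrite horner0.
have := dwithinD (dwithin_idM IH) (dwithin_cst A c t).
rewrite addr0 derivD derivM derivX derivC addr0 mulr1 hornerD hornerM hornerX.
rewrite mulrC addrC.
by apply: dwithin_near; [apply: (@filterE _ (nbhs t)) => s As; split => //|];
  rewrite !hornerE mulrC.
Qed.

(** Interior points have [[a, b]] as a neighbourhood, so the derivative there is two-sided; at the
    endpoints [dwithin] gives the continuity that the mean value theorem asks for. *)
Lemma MVT_dwithin f df a b : a < b ->
  (forall t, a <= t <= b -> dwithin `[a, b] f t (df t)) ->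
  exists2 c, a <= c <= b & f b - f a = df c * (b - a).
Proof.
move=> ab fd.
have [c cab ->] : exists2 c, c \in `]a, b[%R & f b - f a = df c * (b - a).
  apply: MVT => //.
  - move=> x xab.
    have fx : dwithin `[a, b] f x (df x).
      by apply: fd; apply/andP; split; apply/ltW; rewrite (itvP xab).
    have : (fun h : R => h^-1 *: (f (h *: (1 : R) + x) - f x)) @ 0^' --> df x.
      apply/cvgrPdist_le => e e0.
      have := fx _ e0 => H.
      have {}H : \forall s \near x,
          `|f s - f x - df x * (s - x)| <= e * `|s - x|.
        near=> s; have : `[a, b]%classic s.
          apply: subset_itv_oo_cc; near: s; exact: near_in_itvoo.
        by near: s.
      have /nbhs_ballP[r/= r0 {}H] := H.
      exists r => //= h/=; rewrite sub0r normrN => hr h0.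
      have h0' : 0 < `|h| by rewrite normr_gt0.
      have : `|f (h + x) - f x - df x * (h + x - x)| <= e * `|h + x - x|.
        by apply: H; rewrite /ball/= opprD addrCA subrr addr0 normrN.
      rewrite addrK -ler_pdivrMr//; apply: le_trans.
      rewrite -normf_div -normrN le_eqVlt; apply/orP; left; apply/eqP.
      by congr (`| _ |); rewrite /GRing.scale/= mulr1; field.
    move=> fh; apply: DeriveDef; last exact: cvg_lim fh.
    by apply/cvg_ex; exists (df x); exact: fh.
  - apply/subspace_continuousP => x xab.
    apply/cvgrPdist_le => e e0; rewrite near_withinE.
    have := dwithin_continuous (fd x xab) e0.
    by apply: (@filterS _ (nbhs x)) => s H Hs; rewrite distrC; apply: H.
by exists c => //; apply/andP; split; apply/ltW; rewrite (itvP cab).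
Unshelve. all: by end_near. Qed.

Lemma dwithin_lipschitz f df a b (K : R) :
  (forall t, a <= t <= b -> dwithin `[a, b] f t (df t)) ->
  (forall t, a <= t <= b -> `|df t| <= K) ->
  forall s t, a <= s <= b -> a <= t <= b -> `|f s - f t| <= K * `|s - t|.
Proof.
move=> fd fB.
have H s t : s < t -> a <= s <= b -> a <= t <= b -> `|f s - f t| <= K * `|s - t|.
  move=> st /andP[as_ sb] /andP[at_ tb].
  have sub u : s <= u <= t -> a <= u <= b.
    by move=> /andP[su ut]; rewrite (le_trans as_ su) (le_trans ut tb).
  have [u|c sct E] := @MVT_dwithin f df s t st.
    move=> /sub/fd; apply: sub_dwithin => x; rewrite /= !in_itv/=.
    exact: sub.
  rewrite distrC [`|s - t|]distrC E normrM ler_wpM2r//; exact/fB/sub.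
move=> s t sab tab; case: (ltgtP s t) => [st|ts|->]; first exact: H.
  by rewrite distrC [`|s - t|]distrC H.
by rewrite !subrr normr0 mulr0.
Qed.

End DerivativeWithin.

(** * Almost everywhere differentiable Lipschitz functions *)

Section AlmostEverywhere.
Context {R : realType}.
Implicit Types (f : R -> R) (a b : R).
Local Notation mu := (@lebesgue_measure R).

Lemma ae_imply (P Q : R -> Prop) : (forall t, P t -> Q t) ->
  {ae mu, forall t, P t} -> {ae mu, forall t, Q t}.
Proof. by move=> PQ; apply: negligibleS => t nQ /PQ. Qed.

Lemma ae_and (P Q : R -> Prop) : {ae mu, forall t, P t} ->
  {ae mu, forall t, Q t} -> {ae mu, forall t, P t /\ Q t}.
Proof.
by move=> aP aQ; apply: negligibleS (negligibleU aP aQ) => t /not_andP.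
Qed.

Lemma ae_neq (a : R) : {ae mu, forall t, t <> a}.
Proof.
exists [set a]; split; [exact: measurable_set1|exact: lebesgue_measure_set1|].
by move=> t /contrapT.
Qed.

(** Continuous induction: the supremum of the points where [f] is at most [f a] is such a point by
    the Lipschitz bound, and a further step to the right contradicts maximality unless it is [b]. *)
Lemma le_of_right_steps f a b C : a <= b ->
  (forall s t, a <= s <= b -> a <= t <= b -> `|f s - f t| <= C * `|s - t|) ->
  (forall t, a <= t < b -> exists2 s, t < s <= b & f s <= f t) ->
  f b <= f a.
Proof.
move=> ab fC step.
pose S := [set s | a <= s <= b /\ f s <= f a].
have Sa : S a by rewrite /S/= lexx ab.
have ubS : ubound S b by move=> s [/andP[]].
have supS : has_sup S by split; [exists a|exists b].
have leS x : S x -> x <= sup S by exact: sup_upper_bound.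
have aS : a <= sup S by exact: leS.
have Sb : sup S <= b by apply: ge_sup => //; exists a.
have fS : f (sup S) <= f a.
  apply/ler_addgt0Pr => e e0.
  have C1 : 0 < `|C| + 1 by rewrite ltr_wpDl.
  have [s [/andP[as_ sb] fs] cs] := sup_adherent (divr_gt0 e0 C1) supS.
  have sS : s <= sup S by apply: leS; split => //; rewrite as_.
  have : `|f (sup S) - f s| <= e.
    rewrite (le_trans (fC _ _ _ _)) ?aS ?as_//.
    rewrite ger0_norm ?subr_ge0// (@le_trans _ _ ((`|C| + 1) * (sup S - s)))//.
      by rewrite ler_wpM2r ?subr_ge0// (le_trans (ler_norm C))// lerDl.
    by rewrite mulrC -ler_pdivlMr// lerBlDr -lerBlDl ltW.
  move=> /(le_trans (ler_norm _)); rewrite lerBlDl => /le_trans; apply.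
  by rewrite lerD2r.
move: Sb; rewrite le_eqVlt => /predU1P[<-//|Sb].
have [|s /andP[Ss sb] fs] := step (sup S); first by rewrite aS.
suff : s <= sup S by rewrite leNgt Ss.
apply: leS.
split; last exact: le_trans fS.
by rewrite sb (le_trans aS (ltW Ss)).
Qed.

(* If [U] is an open set of measure less than [e] containing the exceptional null
   set, then [f t - (L + e) t - K mu (U `&` ]a, t])] can be continued to the right
   of any [t] without increasing: for [t] in [U] thanks to the last term. *)
Lemma le_of_ae_derivative_le f a b K L : 0 <= K -> 0 <= L -> a < b ->
  (forall s t, a <= s <= b -> a <= t <= b -> `|f s - f t| <= K * `|s - t|) ->
  {ae mu, forall t, a <= t <= b -> exists2 d, dwithin `[a, b] f t d & d <= L} ->
  f b - f a <= L * (b - a).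
Proof.
move=> K0 L0 ab fK [E [mE E0 badE]].
suff H e : 0 < e -> f b - f a <= (L + e) * (b - a) + K * e.
  apply/ler_addgt0Pr => e e0.
  have C0 : 0 < b - a + K + 1 by rewrite ltr_wpDl// addr_ge0// subr_ge0 ltW.
  have := H _ (divr_gt0 e0 C0); move/le_trans; apply.
  rewrite mulrDl -addrA lerD2l mulrC -mulrDl mulrCA ler_piMr ?ltW//.
  by rewrite ltr_pdivrMr// mul1r ltrDl.
move=> e0.
have [|U [oU EU UE]] := @lebesgue_regularity_outer R E e mE _ e0.
  exact: (eq_ind_r (fun x => (x < +oo)%E) (ltry 0) E0).
have mU : measurable U by exact: open_measurable.
have Ue : (mu U < e%:E)%E.
  have -> : U = (U `\` E) `|` E.
    by rewrite setUC setDUK.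
  have mUE : measurable (U `\` E) by exact: measurableD.
  have UEE : (mu (U `\` E `|` E) <= mu (U `\` E) + mu E)%E by exact: measureU2.
  have E0' : mu E = 0%E := E0.
  by rewrite E0' adde0 in UEE; exact: le_lt_trans UEE UE.
pose V s t := (mu (U `&` `]s, t]))%E.
have mV s t : measurable (U `&` `]s, t]) by exact: measurableI.
have Vle s t : s <= t -> (V s t <= (t - s)%:E)%E.
  move=> st; apply: (@le_trans _ _ (mu `]s, t])).
    apply: le_measure; last exact: subIsetr.
      by apply: mem_set; exact: mV.
    exact: mem_set.
  rewrite lebesgue_measure_itv/= lte_fin; case: ifPn => // _.
  by rewrite lee_fin subr_ge0.
have Vfin s t : s <= t -> V s t \is a fin_num.
  move=> st; rewrite ge0_fin_numE ?measure_ge0//.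
  by apply: le_lt_trans (Vle _ _ st) _; rewrite ltry.
have VD s t : a <= s -> s <= t -> fine (V a t) = fine (V a s) + fine (V s t).
  move=> as_ st; rewrite -fineD ?Vfin//; congr fine.
  rewrite /V -measureU; [|exact: mV|exact: mV|].
    by rewrite -setIUr (@itv_bndbnd_setU _ _ _ (BRight s))//= bnd_simp.
  rewrite setIACA setIid; apply/seteqP; split => // x [_ /=].
  by rewrite !in_itv/= => -[/andP[_ xs] /andP[]]; rewrite ltNge xs.
have V0 s t : 0 <= fine (V s t) by rewrite fine_ge0// measure_ge0.
have V1 s t : s <= t -> fine (V s t) <= t - s.
  by move=> st; rewrite -lee_fin fineK ?Vfin// Vle.
have VE s t : s <= t -> `]s, t] `<=` U -> fine (V s t) = t - s.
  move=> st /setIidr; rewrite /V => ->.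
  rewrite lebesgue_measure_itv/= lte_fin; case: ltgtP st => // ->.
  by rewrite subrr.
pose psi t := f t - (L + e) * t - K * fine (V a t).
have : psi b <= psi a.
  apply: (@le_of_right_steps _ _ _ (K + (L + e) + K)); first exact: ltW.
    have H s t : a <= s <= b -> a <= t <= b -> s <= t ->
        `|psi s - psi t| <= (K + (L + e) + K) * `|s - t|.
      move=> sab tab st.
      have -> : psi s - psi t = (f s - f t) + - ((L + e) * (s - t))
          + K * fine (V s t).
        by rewrite /psi (VD s t)//; [ring|case/andP: sab].
      rewrite (le_trans (ler_normD _ _))// [leRHS]mulrDl lerD//.
        rewrite (le_trans (ler_normD _ _))// [leRHS]mulrDl lerD//; first exact: fK.
        by rewrite normrN normrM ler_wpM2r// ger0_norm// addr_ge0// ltW.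
      rewrite normrM (ger0_norm K0) ler_wpM2l// ger0_norm// distrC.
      by rewrite ger0_norm ?subr_ge0// V1.
    move=> s t sab tab; have [st|/ltW ts] := leP s t; first exact: H.
    by rewrite distrC [`|s - t|]distrC; exact: H.
  move=> t /andP[at_ tb].
  have [Et|nEt] := pselect (E t).
    have /nbhs_ballP[r/= r0 tU] : nbhs t U.
      by apply: open_nbhs_nbhs; split => //; exact: EU.
    (* Halving [r] keeps []t, s]] inside the ball, hence inside [U]; the minimum keeps [s] in
       [[a, b]]. *)
    pose s := Num.min b (t + r / 2).
    have ts : t < s by rewrite /s lt_min tb ltrDl divr_gt0.
    have sb : s <= b by rewrite /s ge_min lexx.
    exists s; first by rewrite ts.
    have sE : fine (V t s) = s - t.
      apply: VE; first exact: ltW.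
      move=> x; rewrite /= in_itv/= => /andP[tx xs]; apply: tU.
      rewrite /ball/= distrC gtr0_norm ?subr_gt0// ltrBlDl.
      apply: (le_lt_trans xs); apply: (@le_lt_trans _ _ (t + r / 2)).
        by rewrite /s ge_min lexx orbT.
      by rewrite ltrD2l ltr_pdivrMr// ltr_pMr// ltr1n.
    rewrite /psi (VD t s) ?sE ?(ltW ts)//.
    have : f s - f t <= K * (s - t).
      rewrite (le_trans (ler_norm _))// (le_trans (fK _ _ _ _));
        rewrite ?at_ ?(ltW tb) ?sb ?andbT//.
        by rewrite (le_trans at_ (ltW ts)).
      by rewrite gtr0_norm ?subr_gt0.
    have : 0 <= (L + e) * (s - t).
      by apply: mulr_ge0; [exact: addr_ge0 _ (ltW e0)|rewrite subr_ge0 ltW].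
    move=> H1 H2; rewrite -subr_ge0.
    have -> : f t - (L + e) * t - K * fine (V a t) -
        (f s - (L + e) * s - K * (fine (V a t) + (s - t))) =
      (L + e) * (s - t) + (K * (s - t) - (f s - f t)) by ring.
    by rewrite addr_ge0// subr_ge0.
  (* Outside [E] the slack [e] in [psi] absorbs the error of the linear approximation. *)
  have [d fd dL] : exists2 d, dwithin `[a, b] f t d & d <= L.
    apply: contrapT => nd; apply: nEt; apply: badE => /= H; apply: nd.
    by apply: H; rewrite at_ ltW.
  have /nbhs_ballP[r/= r0 fr] := fd _ e0.
  pose s := Num.min b (t + r / 2).
  have ts : t < s by rewrite /s lt_min tb ltrDl divr_gt0.
  have sb : s <= b by rewrite /s ge_min lexx.
  exists s; first by rewrite ts.
  have : `|f s - f t - d * (s - t)| <= e * `|s - t|.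
    apply: fr; last by rewrite /= in_itv/= sb (le_trans at_ (ltW ts)).
    rewrite /ball/= distrC gtr0_norm ?subr_gt0// ltrBlDl.
    apply: (@le_lt_trans _ _ (t + r / 2)).
      by rewrite /s ge_min lexx orbT.
    by rewrite ltrD2l ltr_pdivrMr// ltr_pMr// ltr1n.
  move=> /(le_trans (ler_norm _)); rewrite gtr0_norm ?subr_gt0// => fst.
  rewrite /psi (VD t s) ?(ltW ts)//.
  have : 0 <= (L - d) * (s - t).
    by apply: mulr_ge0; rewrite subr_ge0// ltW.
  have : 0 <= K * fine (V t s) by rewrite mulr_ge0.
  move=> H1 H2; rewrite -subr_ge0.
  have -> : f t - (L + e) * t - K * fine (V a t) -
      (f s - (L + e) * s - K * (fine (V a t) + fine (V t s))) =
    K * fine (V t s) + (L - d) * (s - t)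
      + (e * (s - t) - (f s - f t - d * (s - t))) by ring.
  by apply: addr_ge0; [exact: addr_ge0|rewrite subr_ge0].
have : 0 <= K * fine (V a a) by rewrite mulr_ge0.
have : K * fine (V a b) <= K * e.
  rewrite ler_wpM2l// -lee_fin fineK ?Vfin ?(ltW ab)//.
  apply: (le_trans _ (ltW Ue)); apply: le_measure; last exact: subIsetl.
    by apply: mem_set; exact: mV.
  exact: mem_set.
move=> H1 H2; rewrite -subr_ge0 => H3; rewrite -subr_ge0.
have -> : (L + e) * (b - a) + K * e - (f b - f a) =
  (psi a - psi b) + K * fine (V a a) + (K * e - K * fine (V a b)).
  by rewrite /psi; ring.
by apply: addr_ge0; [exact: addr_ge0|rewrite subr_ge0].
Qed.

Lemma le_norm_of_ae_derivative_le f a b K L : 0 <= K -> 0 <= L -> a < b ->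
  (forall s t, a <= s <= b -> a <= t <= b -> `|f s - f t| <= K * `|s - t|) ->
  {ae mu, forall t, a <= t <= b ->
    exists2 d, dwithin `[a, b] f t d & `|d| <= L} ->
  `|f b - f a| <= L * (b - a).
Proof.
move=> K0 L0 ab fK fL; rewrite ler_norml lerNl; apply/andP; split; last first.
  apply: (le_of_ae_derivative_le K0) => //.
  move: fL; apply: ae_imply => t ft /ft[d fd dL].
  by exists d => //; exact: le_trans (ler_norm d) dL.
have -> : - (f b - f a) = -1 * f b - -1 * f a by ring.
apply: (@le_of_ae_derivative_le (fun u => -1 * f u) _ _ K) => //.
  move=> s t sab tab; rewrite -mulrBr normrM normrN1 mul1r; exact: fK.
move: fL; apply: ae_imply => t ft /ft[d fd dL].
exists (-1 * d); first exact: dwithinZ.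
by rewrite mulN1r; apply: le_trans dL; rewrite -normrN ler_norm.
Qed.

(** Reflection preserves the length of intervals, so the pushforward of Lebesgue measure under it is
    Lebesgue measure by uniqueness, and null sets reflect to null sets. *)
Lemma ae_reflect (P : R -> Prop) a :
  {ae mu, forall t, P t} -> {ae mu, forall t, P (a - t)}.
Proof.
move=> [E [mE E0 PE]].
have mf : measurable_fun setT (fun t : R => a - t : R).
  by apply: measurable_funB => //; exact: measurable_id.
have mfE : measurable [set t | E (a - t)].
  by rewrite -[X in measurable X]setTI; exact: mf.
exists [set t | E (a - t)]; split => //; last by move=> t /PE.
have <- : mu E = mu [set t | E (a - t)]; last by [].
have := @lebesgue_measure_unique R
  (@pushforward _ _ (measurableTypeR R) (measurableTypeR R) R mu (fun t => a - t)).
apply => // X [[x y] _ <-] /=; rewrite /pushforward/=.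
have -> : (fun t : R => a - t) @^-1` `]x, y] = `[(a - y), (a - x)[%classic.
  apply/seteqP; split => t /=; rewrite !in_itv/= => /andP[? ?]; apply/andP; split; lra.
rewrite !lebesgue_measure_itv/= !lte_fin ltrD2l ltrN2; case: ifP => // _.
by rewrite -!EFinD; congr (_%:E); ring.
Qed.

End AlmostEverywhere.

(** * Jets *)

Section Jets.
Context {R : realType}.
Implicit Types (A B : set R) (f g : R -> R) (F G : nat -> R -> R).
Local Notation mu := (@lebesgue_measure R).

Lemma halflineP (t : R) : halfline t <-> 0 <= t.
Proof. by rewrite /halfline/= in_itv/= andbT. Qed.

Lemma dwithin_cvgP A f t d :
  (f s - f t) / (s - t) @[s --> within A t^'] --> d <-> dwithin A f t d.
Proof.
split=> [/cvgrPdist_le fd e e0|fd].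
  have := fd _ e0; rewrite near_withinE near_withinE.
  apply: (@filterS _ (nbhs t)) => s fs As.
  have [->|st] := eqVneq s t; first by rewrite !subrr mulr0 subrr normr0 mulr0.
  have := fs st As; rewrite -ler_pdivrMr ?normr_gt0 ?subr_eq0//; apply: le_trans.
  rewrite -normf_div -normrN le_eqVlt; apply/orP; left; apply/eqP.
  by congr (`| _ |); field; rewrite subr_eq0.
apply/cvgrPdist_le => e e0; rewrite near_withinE near_withinE.
have := fd _ e0; apply: (@filterS _ (nbhs t)) => s fs st As.
have := fs As; rewrite -ler_pdivrMr ?normr_gt0 ?subr_eq0//; apply: le_trans.
rewrite -normf_div -normrN le_eqVlt; apply/orP; left; apply/eqP.
by congr (`| _ |); field; rewrite subr_eq0.
Qed.

(** Makes the limit in [hderive] unique: points to the right of [t] accumulate at [t], also for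
    [t = 0]. *)
Lemma within_halfline_proper (t : R) : 0 <= t ->
  ProperFilter (within halfline t^').
Proof.
move=> t0; apply: Build_ProperFilter_ex => P /nbhs_ballP[r/= r0 H].
exists (t + r / 2); apply: H.
- rewrite /ball/= opprD addNKr normrN gtr0_norm ?divr_gt0//.
  by rewrite ltr_pdivrMr// ltr_pMr// ltr1n.
- by rewrite -subr_eq0 addrC addKr gt_eqF// divr_gt0.
- by apply/halflineP; rewrite addr_ge0// ltW// divr_gt0.
Qed.

Lemma dwithin_hderivable f t d : dwithin halfline f t d -> hderivable f t.
Proof. by move=> /dwithin_cvgP fd; apply/cvg_ex; exists d. Qed.

Lemma dwithin_hderive f t d : 0 <= t -> dwithin halfline f t d -> hderive f t = d.
Proof.
by move=> /within_halfline_proper pt /dwithin_cvgP fd; apply: cvg_lim.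
Qed.

Lemma hderivableP f t : hderivable f t -> dwithin halfline f t (hderive f t).
Proof. by move=> fd; apply/dwithin_cvgP. Qed.

Lemma dwithin_le_lipschitz f t d L : 0 <= t ->
  (forall s, 0 <= s -> `|f s - f t| <= L * `|s - t|) ->
  dwithin halfline f t d -> `|d| <= L.
Proof.
move=> t0 fL fd; apply/ler_addgt0Pr => e e0.
have /nbhs_ballP[r/= r0 H] := fd _ e0.
have st : t + r / 2 - t = r / 2 by rewrite addrC addKr.
have r20 : 0 < r / 2 by rewrite divr_gt0.
have ts : 0 <= t + r / 2 by rewrite addr_ge0// ltW.
have := H (t + r / 2); rewrite /ball/= opprD addNKr normrN gtr0_norm//.
rewrite ltr_pdivrMr// ltr_pMr// ltr1n => /(_ isT (proj2 (halflineP _) ts)).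
have := fL _ ts; rewrite st (gtr0_norm r20) => H1 H2.
rewrite -(ler_pM2r r20) -[X in _ * X <= _](gtr0_norm r20) -normrM.
have -> : d * (r / 2) = (f (t + r / 2) - f t) -
   (f (t + r / 2) - f t - d * (r / 2)) by ring.
by rewrite (le_trans (ler_normB _ _))// mulrDl lerD.
Qed.

(* The bound on the derivative of [F m] is the Lipschitz condition; that this
   derivative exists a.e. is carried along, to avoid Lebesgue's theorem on the
   differentiability of Lipschitz functions. *)
Definition jet A (m : nat) (L : R) F : Prop :=
  [/\ forall i t, (i < m)%N -> A t -> dwithin A (F i) t (F i.+1 t),
      forall s t, A s -> A t -> `|F m s - F m t| <= L * `|s - t|
    & {ae mu, forall t, A t -> exists d, dwithin A (F m) t d}].

(** Membership in [Fcal] gives some Lipschitz constant [K] for the top derivative; the almost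
    everywhere bound on its derivative sharpens [K] to [L]. *)
Lemma FcalL_jet m L f : 0 <= L -> FcalL m L f ->
  jet halfline m L (fun i => hderiven i f).
Proof.
move=> L0 [[fd _ fK] fL].
have [K K0 {}fK] : exists2 K, 0 <= K & forall s t, 0 <= s -> 0 <= t ->
    `|hderiven m f s - hderiven m f t| <= K * `|s - t|.
  near (pinfty_nbhs R) => K; exists K; first by [].
  move=> s t s0 t0.
  have : (fun K => forall p : R * R, (halfline `*` halfline) p ->
     `|hderiven m f p.1 - hderiven m f p.2| <= K * `|p.1 - p.2|) K.
    by near: K; apply: fK.
  by move=> /(_ (s, t)); apply; split; apply/halflineP.
split => [i t im At||].
- by apply: hderivableP; apply: fd => //; exact: mem_set.
- have H s t : 0 <= s -> s < t ->
      `|hderiven m f t - hderiven m f s| <= L * `|t - s|.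
    move=> s0 st; rewrite (gtr0_norm (x := t - s)) ?subr_gt0//.
    have pos u : s <= u <= t -> halfline u.
      by move=> /andP[su _]; apply/halflineP; exact: le_trans su.
    apply: (@le_norm_of_ae_derivative_le R (hderiven m f) s t K L K0 L0 st).
      by move=> u v /pos/halflineP u0 /pos/halflineP v0; exact: fK.
    move: fL; apply: ae_imply => u fu ust; have [fdu fdL] := fu (pos _ ust).
    exists (hderive (hderiven m f) u) => //.
    by apply: sub_dwithin (hderivableP fdu) => v /=; rewrite in_itv/= => /pos.
  move=> s t /halflineP s0 /halflineP t0; case: (ltgtP s t) => [st|ts|->].
  + by rewrite distrC [`|s - t|]distrC; exact: H.
  + exact: H.
  + by rewrite !subrr normr0 mulr0.
- move: fL; apply: ae_imply => t ft At.
  by exists (hderive (hderiven m f) t); have [/hderivableP] := ft At.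
Unshelve. all: by end_near. Qed.

End Jets.

(** * Jets as members of [FcalL], and operations on jets *)

Section JetOperations.
Context {R : realType}.
Implicit Types (A B : set R) (f g : R -> R) (F G : nat -> R -> R).
Local Notation mu := (@lebesgue_measure R).

Lemma jet_hderiven m L F : jet halfline m L F ->
  forall i t, (i <= m)%N -> 0 <= t -> hderiven i (F 0%N) t = F i t.
Proof.
move=> [Fd _ _]; elim=> [//|i IH] t im t0; apply: dwithin_hderive => //.
change (dwithin halfline (hderiven i (F 0%N)) t (F i.+1 t)).
apply: (dwithin_near _ _ (Fd i t im _)); last exact/halflineP.
  apply: (@filterE _ (nbhs t)) => s s0; split => //.
  by rewrite IH// ?(ltnW im)//; exact/halflineP.
by rewrite IH// (ltnW im).
Qed.

Lemma within_halfline_continuous f :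
  (forall t e : R, 0 <= t -> 0 < e ->
    \forall s \near t, halfline s -> `|f s - f t| <= e) ->
  {within halfline, continuous f}.
Proof.
move=> fc; apply/subspace_continuousP => t /halflineP t0.
apply/cvgrPdist_le => e e0; rewrite near_withinE.
have := fc _ _ t0 e0.
by apply: (@filterS _ (nbhs t)) => s + Hs; rewrite distrC; apply.
Qed.

(** Converse of [FcalL_jet]: the Lipschitz constant [L] bounds the derivative of [F m] wherever it
    exists, and the jet grants existence almost everywhere. *)
Lemma jet_FcalL m L F : jet halfline m L F -> FcalL m L (F 0%N).
Proof.
move=> FJ; have FE := jet_hderiven FJ; have [Fd FL Fae] := FJ.
have dF i t d : (i <= m)%N -> 0 <= t ->
    dwithin halfline (F i) t d -> dwithin halfline (hderiven i (F 0%N)) t d.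
  move=> im t0; apply: dwithin_near; last by rewrite FE.
  apply: (@filterE _ (nbhs t)) => s s0; split => //.
  by rewrite FE//; exact/halflineP.
split.
  split.
  - move=> i im t /set_mem At; apply: dwithin_hderivable.
    apply: dF; [exact: ltnW|exact/halflineP|exact: Fd].
  - move=> i im; apply: within_halfline_continuous => t e t0 e0.
    move: im; rewrite leq_eqVlt => /predU1P[->|im]; last first.
      apply: dwithin_continuous e0; apply: dF; [exact: ltnW|by []|].
      by apply: Fd => //; exact/halflineP.
    have L1 : 0 < `|L| + 1 by rewrite ltr_wpDl.
    apply/nbhs_ballP; exists (e / (`|L| + 1)); first by rewrite /= divr_gt0.
    move=> s ts As; rewrite !FE//; last exact/halflineP.
    rewrite (le_trans (FL _ _ _ _))//; first exact/halflineP.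
    rewrite (@le_trans _ _ ((`|L| + 1) * `|s - t|))//.
      by rewrite ler_wpM2r// (le_trans (ler_norm L))// lerDl.
    by rewrite mulrC -ler_pdivlMr// distrC ltW.
  - exists L; split; first exact: num_real.
    move=> K LK [s t] [/= As At]; rewrite !FE//; try exact/halflineP.
    by rewrite (le_trans (FL _ _ As At))// ler_wpM2r// ltW.
apply: ae_imply Fae => t Ft At; have [d Fdt] := Ft At.
have t0 : 0 <= t by exact/halflineP.
have := dF m t d (leqnn m) t0 Fdt => hd; split; first exact: dwithin_hderivable hd.
rewrite -[hderiven m.+1 _ t]/(hderive (hderiven m (F 0%N)) t).
rewrite (dwithin_hderive t0 hd).
by apply: dwithin_le_lipschitz Fdt => // s s0; apply: FL => //; exact/halflineP.
Qed.

Lemma sub_jet A B m L F : B `<=` A -> jet A m L F -> jet B m L F.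
Proof.
move=> BA [Fd FL Fae]; split.
- by move=> i t im /BA At; apply: sub_dwithin (Fd i t im At).
- by move=> s t /BA As /BA At; exact: FL.
- apply: ae_imply Fae => t Ft /BA/Ft[d Fdt]; exists d; exact: sub_dwithin Fdt.
Qed.

Lemma jet_le A m L L' F : L <= L' -> jet A m L F -> jet A m L' F.
Proof.
move=> LL' [Fd FL Fae]; split => // s t As At.
by rewrite (le_trans (FL _ _ As At))// ler_wpM2r.
Qed.

Lemma jetZ A m L c F : jet A m L F -> jet A m (`|c| * L) (fun i t => c * F i t).
Proof.
move=> [Fd FL Fae]; split.
- by move=> i t im At; apply: dwithinZ; exact: Fd.
- by move=> s t As At; rewrite -mulrBr normrM -mulrA ler_wpM2l// FL.
- apply: ae_imply Fae => t Ft /Ft[d Fdt]; exists (c * d); exact: dwithinZ.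
Qed.

(** Time reversal, by which statements about the value at [a] become statements about the value at
    [0]; each derivative brings a sign. *)
Lemma jet_reflect a m L F : jet `[0, a] m L F ->
  jet `[0, a] m L (fun i t => (-1) ^+ i * F i (a - t)).
Proof.
have Aa t : `[0, a]%classic t <-> `[0, a]%classic (a - t).
  by rewrite /= !in_itv/= subr_ge0 gerBl andbC.
have refl f t d : dwithin `[0, a] f (a - t) d ->
    dwithin `[0, a] (fun s => f (a - s)) t (- d).
  by move=> /dwithin_comp_reflect; apply: sub_dwithin => s /Aa.
move=> [Fd FL Fae]; split.
- move=> i t im /Aa At; rewrite exprSr mulrN1 mulNr -mulrN.
  by apply/dwithinZ/refl/Fd.
- move=> s t /Aa As /Aa At; rewrite -mulrBr normrM normrX normrN1 expr1n mul1r.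
  rewrite (le_trans (FL _ _ As At))//.
  have -> : a - s - (a - t) = - (s - t) by ring.
  by rewrite normrN.
- apply: ae_imply (ae_reflect a Fae) => t Ft /Aa/Ft[d Fdt].
  by exists ((-1) ^+ m * - d); apply/dwithinZ/refl.
Qed.

(** The Leibniz rule for [t / a] times [F 0]. In the new constant, [L] comes from [F m], as
    [t / a <= 1]; one [K / a] comes from the slope of [t / a], and [m] more from [m%:R * F m.-1]. *)
Lemma jet_idM (a : R) m L (K : R) F : 0 < a -> 0 <= K -> jet `[0, a] m L F ->
  (forall i t, (i <= m)%N -> 0 <= t <= a -> `|F i t| <= K) ->
  jet `[0, a] m (L + m.+1%:R * K / a)
    (fun i t => a^-1 * (t * F i t + i%:R * F i.-1 t)).
Proof.
move=> a0 K0 [Fd FL Fae] FK.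
have At t : `[0, a]%classic t = (0 <= t <= a) :> Prop by rewrite /= in_itv.
split.
- move=> i t im Ait; apply: dwithinZ.
  have -> : t * F i.+1 t + i.+1%:R * F i.+1.-1 t =
     (F i t + t * F i.+1 t) + i%:R * F i t by rewrite -natr1 /=; ring.
  apply: dwithinD; first by apply: dwithin_idM; exact: Fd.
  (* For [i = 0] the truncated predecessor [i.-1] is [0] again, but its factor vanishes. *)
  case: i im => [|i] im; last by apply: dwithinZ; apply: Fd => //; exact: ltnW.
  rewrite mul0r; have := dwithin_cst `[0, a] 0 t.
  by apply: dwithin_near; [apply: (@filterE _ (nbhs t)) => s|]; rewrite mul0r.
(* The factor [m%:R] settles the case [m = 0], where [F m.-1] is [F m] and only the constant [L] is
   known for it. *)
- have lipF : forall s t, 0 <= s <= a -> 0 <= t <= a ->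
      m%:R * `|F m.-1 s - F m.-1 t| <= m%:R * (K * `|s - t|).
    case: m FK FL Fd {Fae} => [|m] FK FL Fd s t sa ta; first by rewrite !mul0r.
    rewrite ler_wpM2l//=; apply: (@dwithin_lipschitz R _ (F m.+1) 0 a) => //.
    - by move=> u ua; apply: Fd => //; rewrite At.
    - by move=> u ua; apply: FK.
  move=> s t; rewrite !At => sa ta.
  have -> : a^-1 * (s * F m s + m%:R * F m.-1 s) -
    a^-1 * (t * F m t + m%:R * F m.-1 t) =
    (s / a) * (F m s - F m t) + a^-1 * (F m t * (s - t)) +
     a^-1 * (m%:R * (F m.-1 s - F m.-1 t)) by ring.
  have -> : (L + m.+1%:R * K / a) * `|s - t| = L * `|s - t| +
     a^-1 * (K * `|s - t|) + a^-1 * (m%:R * (K * `|s - t|)).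
    by rewrite -natr1; ring.
  have ia : `|a^-1| = a^-1 by rewrite gtr0_norm// invr_gt0.
  have ia0 : 0 <= a^-1 by rewrite invr_ge0 ltW.
  rewrite (le_trans (ler_normD _ _))// lerD//; last first.
    by rewrite !normrM ia normr_nat ler_wpM2l// lipF.
  rewrite (le_trans (ler_normD _ _))// lerD//; last first.
    by rewrite normrM ia normrM ler_wpM2l// ler_wpM2r// FK.
  rewrite normrM (le_trans _ (FL s t _ _)) ?At// ler_piMl//.
  case/andP: sa => s0 sa.
  by rewrite ger0_norm ?divr_ge0// ?(ltW a0)// ler_pdivrMr// mul1r.
- apply: ae_imply Fae => t Ft Ait; have [d Fdt] := Ft Ait.
  case: m Fd {FL FK Ft} Fdt => [|m] Fd Fdt.
    exists (a^-1 * (F 0%N t + t * d + 0)); apply/dwithinZ/dwithinD.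
      exact: dwithin_idM.
    have := dwithin_cst `[0, a] 0 t.
    by apply: dwithin_near; [apply: (@filterE _ (nbhs t)) => s|]; rewrite mul0r.
  exists (a^-1 * (F m.+1 t + t * d + m.+1%:R * F m.+1 t)).
  apply/dwithinZ/dwithinD; first exact: dwithin_idM.
  by apply: dwithinZ; exact: Fd.
Qed.

(* The extension continues [F] beyond [a] by its Taylor polynomial at [a]. *)
Lemma jet_extend (a : R) m (L : R) F : 0 <= a -> 0 <= L -> jet `[0, a] m L F ->
  exists2 G, jet halfline m L G &
    forall i t, (i <= m)%N -> 0 <= t <= a -> G i t = F i t.
Proof.
move=> a0 L0 [Fd FL Fae].
have At t : `[0, a]%classic t = (0 <= t <= a) :> Prop by rewrite /= in_itv.
pose P : {poly R} := \poly_(j < m.+1) (F j a / j`!%:R).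
pose G i t := if t <= a then F i t else (P^`(i)).[t - a].
have Pa i : (i <= m)%N -> (P^`(i)).[0] = F i a.
  move=> im; rewrite horner_coef0 coef_derivn addn0 ffactnn coef_poly ltnS im.
  by rewrite -[LHS]mulr_natr divfK// pnatr_eq0 -lt0n fact_gt0.
have GF i t : t <= a -> G i t = F i t by rewrite /G => ->.
have GP i t : (i <= m)%N -> a <= t -> G i t = (P^`(i)).[t - a].
  move=> im; rewrite /G le_eqVlt => /predU1P[<-|]; last by rewrite leNgt => ->.
  by rewrite lexx subrr Pa.
have Pm : P^`(m) = (F m a)%:P.
  have sP : (size P^`(m) <= 1)%N.
    apply/leq_sizeP => j j1; rewrite coef_derivn coef_poly ltnS.
    by rewrite leqNgt -addn1 leq_add2l j1/= mul0rn.
  by rewrite (size1_polyC sP) -horner_coef0 Pa.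
have split_halfline t : halfline t -> 0 <= t <= a \/ a <= t.
  move=> /halflineP t0; have [ta|/ltW ta] := leP t a; last by right.
  by left; rewrite t0.
have dG i t d : (i <= m)%N -> halfline t ->
    (t <= a -> dwithin `[0, a] (F i) t d) ->
    (a <= t -> (P^`(i.+1)).[t - a] = d) -> dwithin halfline (G i) t d.
  move=> im t0 dF dP.
  (* If [t] lies off one of the two pieces, no point near [t] belongs to that piece and its
     condition is vacuous. *)
  have right_side : dwithin `[a, +oo[ (G i) t d.
    have [ta|at_] := ltP t a.
      move=> e e0; have ta0 : 0 < a - t by rewrite subr_gt0.
      apply/nbhs_ballP; exists (a - t) => //= s.
      rewrite /ball/= distrC => /(le_lt_trans (ler_norm _)).
      by rewrite ltrD2r in_itv/= andbT ltNge => /negbTE ->.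
    have := sub_dwithin (@subsetT _ `[a, +oo[)
      (dwithin_comp_sub (dwithin_horner setT P^`(i) (t - a))).
    rewrite -derivnS dP//; apply: dwithin_near; last by rewrite GP.
    apply: (@filterE _ (nbhs t)) => s as_; split => //.
    by rewrite GP//; move: as_; rewrite /= in_itv/= andbT.
  have left_side : dwithin `[0, a] (G i) t d.
    have [ta|at_] := leP t a.
      apply: (dwithin_near _ _ (dF ta)); last by rewrite GF.
      apply: (@filterE _ (nbhs t)) => s sa; split => //.
      by rewrite GF//; move: sa; rewrite At => /andP[].
    move=> e e0; have ta0 : 0 < t - a by rewrite subr_gt0.
    apply/nbhs_ballP; exists (t - a) => //= s.
    rewrite /ball/= => /(le_lt_trans (ler_norm _)).
    by rewrite ltrD2l ltrN2 in_itv/= ltNge => /negbTE ->; rewrite andbF.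
  apply: sub_dwithin (dwithin_setU left_side right_side) => s.
  by move=> /split_halfline[|]; [left|right]; rewrite /= in_itv// andbT.
exists G; last by move=> i t im /andP[t0 ta]; rewrite GF.
split.
- move=> i t im t0; apply: dG; first exact: ltnW.
  + by [].
  + move=> ta; rewrite GF//; apply: Fd => //.
    by rewrite At ta andbT; exact/halflineP.
  + by move=> at_; rewrite GP.
(* The Taylor polynomial has constant [m]-th derivative, so [G m] is [F m] frozen after [a];
   truncating times at [a] does not increase distances. *)
- have Gm t : halfline t -> G m t = F m (Num.min t a).
    move=> t0; have [ta|/ltW at_] := leP t a; first by rewrite GF.
    by rewrite GP// Pm hornerC.
  have ma t : halfline t -> `[0, a]%classic (Num.min t a).
    by move=> /halflineP t0; rewrite At ge_min lexx orbT andbT le_min t0.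
  move=> s t s0 t0; rewrite !Gm// (le_trans (FL _ _ (ma _ s0) (ma _ t0)))//.
  rewrite ler_wpM2l//.
  case: (leP s a) => sa; case: (leP t a) => ta //.
  + by rewrite !ler0_norm ?subr_le0// ?(le_trans sa (ltW ta))// lerN2 lerD2l lerN2 ltW.
  + by rewrite !ger0_norm ?subr_ge0// ?(le_trans ta (ltW sa))// lerD2r ltW.
  + by rewrite subrr normr0.
(* At the junction [a] the one-sided derivatives of [G m] may differ; this point is discarded as a
   null set. *)
- apply: ae_imply (ae_and Fae (ae_neq a)) => t [Ft ta] t0.
  have [at_|at_] := leP t a.
    have [d Fdt] : exists d, dwithin `[0, a] (F m) t d.
      by apply: Ft; rewrite At at_ andbT; exact/halflineP.
    exists d; apply: dG => // at2; exfalso; apply: ta.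
    by apply/eqP; rewrite eq_le at_.
  exists (P^`(m.+1)).[t - a]; apply: dG => //.
  by rewrite leNgt at_.
Qed.

End JetOperations.

(** * Bounds on intermediate derivatives *)

Section DerivativeBounds.
Context {R : realType}.
Implicit Types (F G : nat -> R -> R).

(** By induction, [F j] is small at a point [x] of the first third and at a point [y] of the last
    third; the mean value theorem between them makes [F j.+1] small somewhere. *)
Lemma jet_small_derivative_point (j : nat) : exists2 C : R, 0 <= C &
  forall m L F N a w, (j <= m)%N -> 0 < w -> jet `[a, a + w] m L F ->
    (forall t, a <= t <= a + w -> `|F 0%N t| <= N) ->
    exists2 x, a <= x <= a + w & `|F j x| <= C * N / w ^+ j.
Proof.
elim: j => [|j [C C0 IH]].
  exists 1 => // m L F N a w _ w0 _ FN.
  have aw : a <= a <= a + w by rewrite lexx lerDl ltW.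
  by exists a => //; rewrite mul1r expr0 divr1 FN.
(* The [2] counts the values at [x] and [y]; the power of [3] comes from the width [w / 3] of the
   thirds and from [y - x >= w / 3]. *)
exists (2 * C * 3 ^+ j.+1).
  by rewrite mulr_ge0// ?mulr_ge0// exprn_ge0.
move=> m L F N a w jm w0 FJ FN; have w30 : 0 < w / 3 by rewrite divr_gt0.
have N0 : 0 <= N.
  by apply: le_trans (FN a _); rewrite // lexx lerDl ltW.
have sub b : a <= b -> b + w / 3 <= a + w ->
    exists2 x, b <= x <= b + w / 3 & `|F j x| <= C * N / (w / 3) ^+ j.
  move=> ab bw; have inc t : b <= t <= b + w / 3 -> a <= t <= a + w.
    by move=> /andP[bt tb]; rewrite (le_trans ab bt) (le_trans tb bw).
  apply: (IH m L F N b (w / 3)) => //; first exact: ltnW.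
    by apply: sub_jet FJ => t; rewrite /= !in_itv; exact: inc.
  by move=> t /inc; exact: FN.
have [|x /andP[ax xa] Fx] := sub a (lexx _); first by lra.
have [||y /andP[ay ya] Fy] := sub (a + 2 * (w / 3)); [by lra|by lra|].
have xy : w / 3 <= y - x by lra.
have xy0 : x < y by lra.
have [Fd _ _] := FJ.
have [|c /andP[cx cy] E] := @MVT_dwithin R (F j) (F j.+1) x y xy0.
  move=> t /andP[xt ty]; have : dwithin `[a, a + w] (F j) t (F j.+1 t).
    by apply: Fd => //; rewrite /= in_itv/=; apply/andP; split; lra.
  by apply: sub_dwithin => s /=; rewrite !in_itv/= => /andP[? ?];
    apply/andP; split; lra.
exists c; first by apply/andP; split; lra.
have : `|F j.+1 c| * (w / 3) <= 2 * (C * N / (w / 3) ^+ j).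
  rewrite (@le_trans _ _ (`|F j.+1 c| * (y - x)))//; first by rewrite ler_wpM2l.
  rewrite -[X in _ * X <= _](@gtr0_norm _ (y - x)) ?subr_gt0// -normrM -E.
  by rewrite (le_trans (ler_normB _ _))// mulr_natl mulr2n lerD.
rewrite -ler_pdivlMr//; move=> /le_trans; apply.
rewrite le_eqVlt; apply/orP; left; apply/eqP.
have wn : w ^+ j != 0 by rewrite expf_neq0// gt_eqF.
have t3 : (3 : R) ^+ j != 0 by rewrite expf_neq0.
by rewrite !exprS expr_div_n; field; rewrite wn t3 gt_eqF.
Qed.

(** A Landau-Kolmogorov type inequality, by induction on the number [n] of derivatives above the
    [j]-th: from a point where it is small, [F j] varies by at most [w] times the bound on [F j.+1],
    or on its Lipschitz constant if [n = 0]. *)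
Lemma jet_derivative_bound (n j : nat) : exists2 K : R, 0 <= K &
  forall L F N a w, 0 < w -> jet `[a, a + w] (j + n) L F ->
    (forall t, a <= t <= a + w -> `|F 0%N t| <= N) ->
    forall t, a <= t <= a + w -> `|F j t| <= K * N / w ^+ j + L * w ^+ n.+1.
Proof.
have dist (a w x t : R) : a <= x <= a + w -> a <= t <= a + w -> `|t - x| <= w.
  by move=> /andP[? ?] /andP[? ?]; rewrite ler_norml; apply/andP; split; lra.
elim: n j => [|n IH] j; have [C C0 HC] := jet_small_derivative_point j.
  exists C => // L F N a w w0 FJ FN t ta.
  have [|x xa Fx] := HC _ _ _ _ _ _ _ w0 FJ FN; first by rewrite addn0.
  rewrite -[F j t](subrK (F j x)) addrC (le_trans (ler_normD _ _))// lerD//.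
  have [_ FL _] := FJ; rewrite addn0 in FL.
  rewrite (le_trans (FL _ _ _ _)) ?expr1; rewrite /= ?in_itv//.
  (* A negative [L] contradicts the Lipschitz bound between the distinct points [a] and [a + w]. *)
  have [L0|L0] := leP 0 L; first by rewrite ler_wpM2l// (dist a).
  have := FL a (a + w); rewrite /= !in_itv/= lexx lerDl ltW// => /(_ isT).
  rewrite lexx andbT => /(_ isT)/(le_trans (normr_ge0 _)).
  by rewrite nmulr_rge0// normr_le0 subr_eq0 -subr_eq0 opprD addNKr oppr_eq0 gt_eqF.
have [K K0 HK] := IH j.+1.
exists (K + C); first by rewrite addr_ge0.
move=> L F N a w w0 FJ FN t ta.
have [|x xa Fx] := HC _ _ _ _ _ _ _ w0 FJ FN; first by rewrite leq_addr.
have FJ' := FJ; rewrite addnS -addSn in FJ'.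
have [Fd _ _] := FJ.
have H : `|F j t - F j x| <= (K * N / w ^+ j.+1 + L * w ^+ n.+1) * `|t - x|.
  apply: (@dwithin_lipschitz R (F j) (F j.+1) a (a + w)) => //.
  - move=> s sa; apply: Fd; last by rewrite /= in_itv.
    by rewrite addnS ltnS leq_addr.
  - exact: (HK _ _ _ _ _ w0 FJ' FN).
have bd0 : 0 <= K * N / w ^+ j.+1 + L * w ^+ n.+1.
  by apply: le_trans (HK _ _ _ _ _ w0 FJ' FN t ta).
rewrite -[F j t](subrK (F j x)) (le_trans (ler_normD _ _))//.
have -> : (K + C) * N / w ^+ j + L * w ^+ n.+2 =
    (K * N / w ^+ j.+1 + L * w ^+ n.+1) * w + C * N / w ^+ j.
  by rewrite !exprS; field; rewrite expf_neq0 gt_eqF.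
rewrite lerD// (le_trans H)// ler_wpM2l//; exact: (dist a).
Qed.

(** The previous estimate is applied on windows of length 1, so [K] does not depend on [a]; summing
    the constants of all orders serves every order at once. *)
Lemma jet_uniform_bound (m : nat) : exists2 K : R, 0 <= K &
  forall L F N a, 1 <= a -> 0 <= L -> 0 <= N -> jet `[0, a] m L F ->
    (forall t, 0 <= t <= a -> `|F 0%N t| <= N) ->
    forall i t, (i <= m)%N -> 0 <= t <= a -> `|F i t| <= K * N + L.
Proof.
have [K HK] := choice (fun j : nat => let: ex_intro2 K a b :=
  jet_derivative_bound (m - j) j in ex_intro _ K (conj a b)).
exists (\sum_(j < m.+1) K j); first by apply: sumr_ge0 => j _; case: (HK j).
move=> L F N a a1 L0 N0 FJ FN i t im /andP[t0 ta].
(* The start of a unit window that contains [t] and stays inside [[0, a]]. *)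
pose x := Num.min t (a - 1).
have x0 : 0 <= x by rewrite le_min t0/= subr_ge0.
have xt : x <= t by rewrite /x ge_min lexx.
have xa : x + 1 <= a by rewrite -lerBrDr /x ge_min lexx orbT.
have tx : t <= x + 1.
  by rewrite /x; case: (leP t (a - 1)) => _; [rewrite lerDl|rewrite subrK].
have inc s : x <= s <= x + 1 -> 0 <= s <= a.
  by move=> /andP[xs sx]; rewrite (le_trans x0 xs) (le_trans sx xa).
have [_ Hi] := HK i; have := Hi L F N x 1 ltr01.
rewrite subnKC// !expr1n divr1 mulr1 => H.
rewrite (le_trans (H _ _ t _))//.
- by apply: sub_jet FJ => s; rewrite /= !in_itv; exact: inc.
- by move=> s /inc; exact: FN.
- by rewrite xt tx.
- rewrite lerD2r ler_wpM2r// (bigD1 (Ordinal (im : (i < m.+1)%N)))//= lerDl.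
  by apply: sumr_ge0 => j _; case: (HK j).
Qed.

(* Each multiplication by [t / a] makes one more derivative vanish at [0] and
   costs only [O(1 / a)] in the Lipschitz constant and in the values at [a]. *)
Lemma jet_flatten (m : nat) (L N : R) : 0 <= L -> 0 <= N ->
  forall (p : nat) (e : R), 0 < e -> exists2 a0 : R, 1 <= a0 &
  forall a F, a0 <= a -> jet `[0, a] m L F ->
    (forall t, 0 <= t <= a -> `|F 0%N t| <= N) ->
  exists G, [/\ jet `[0, a] m (L + e) G,
    forall t, 0 <= t <= a -> `|G 0%N t| <= N,
    forall i, (i < p)%N -> (i <= m)%N -> G i 0 = 0 &
    forall i, (i <= m)%N -> `|G i a - F i a| <= e].
Proof.
move=> L0 N0; have [K K0 HK] := jet_uniform_bound m.
elim=> [|p IH] e e0.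
  exists 1 => // a F _ FJ FN; exists F; split => //.
    by apply: jet_le FJ; rewrite lerDl ltW.
  by move=> i _; rewrite subrr normr0 ltW.
(* Half of [e] is spent by the induction hypothesis, half by the last multiplication by [t / a]; [B]
   below bounds all derivatives of the jet obtained so far. *)
have e20 : 0 < e / 2 by rewrite divr_gt0.
have [a1 a11 {}IH] := IH _ e20.
pose B := K * N + (L + e / 2).
have Le0 : 0 <= L + e / 2 by rewrite addr_ge0// ltW.
have B0 : 0 <= B by rewrite addr_ge0// mulr_ge0.
exists (Num.max a1 (m.+1%:R * B / (e / 2))); first by rewrite le_max a11.
move=> a F; rewrite ge_max => /andP[a1a Ba] FJ FN.
have a1' : 1 <= a by exact: le_trans a1a.
have a0 : 0 < a by exact: lt_le_trans a1'.
have {}Ba : m.+1%:R * B / a <= e / 2 by rewrite ler_pdivrMr// [leRHS]mulrC -ler_pdivrMr.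
have [G [GJ GN G0 GF]] := IH a F a1a FJ FN.
have GB := HK _ _ _ _ a1' Le0 N0 GJ GN.
exists (fun i t => a^-1 * (t * G i t + i%:R * G i.-1 t)); split.
- apply: jet_le (jet_idM a0 B0 GJ GB).
  by rewrite {2}(splitr e) addrA lerD2l.
- move=> t /andP[t0 ta]; rewrite mul0r addr0 mulrA normrM.
  rewrite (le_trans _ (GN t _)) ?t0// ler_piMl//.
  by rewrite ger0_norm ?mulr_ge0// ?invr_ge0 ?(ltW a0)// mulrC ler_pdivrMr// mul1r.
(* At [0] the term with factor [t] vanishes, and order [i.+1] inherits the zero of order [i]. *)
- case=> [|i] ip im; first by rewrite !mul0r addr0 mulr0.
  by rewrite mul0r add0r G0 ?mulr0// ltnW.
- move=> i im.
  have -> : a^-1 * (a * G i a + i%:R * G i.-1 a) - F i a =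
      (G i a - F i a) + i%:R * G i.-1 a / a by field; rewrite gt_eqF.
  rewrite (splitr e) (le_trans (ler_normD _ _))// lerD ?GF//.
  rewrite (le_trans _ Ba)// !normrM normfV normr_nat (gtr0_norm a0).
  rewrite ler_wpM2r ?invr_ge0 ?(ltW a0)// ler_pM//.
    by rewrite ler_nat ltnW.
  by rewrite GB ?(leq_trans (leq_pred _))// lexx ltW.
Qed.

End DerivativeBounds.

(** * Worst-case error *)

Section WorstCase.
Context {R : realType}.
Implicit Types (F G : nat -> R -> R).

(** The Taylor extension makes a jet on [[0, a]] a competitor in [Gcal]; together with [gbar_le]
    this describes [gbar] by jets on [[0, a]] alone. *)
Lemma gbar_ge m k (L N a : R) F : 0 <= a -> 0 <= L -> (k <= m)%N ->
  jet `[0, a] m L F -> (forall t, 0 <= t <= a -> `|F 0%N t| <= N) ->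
  ((F k a)%:E <= gbar m L N k a)%E.
Proof.
move=> a0 L0 km FJ FN; have [G GJ GF] := jet_extend a0 L0 FJ.
apply: ereal_sup_ubound; exists (G 0%N).
  split; first exact: jet_FcalL GJ.
  by move=> t ta; rewrite GF// FN.
by rewrite (jet_hderiven GJ)// GF// a0 lexx.
Qed.

Lemma gbar_le m k (L N a : R) (x : \bar R) : 0 <= L ->
  (forall F, jet `[0, a] m L F ->
    (forall t, 0 <= t <= a -> `|F 0%N t| <= N) -> ((F k a)%:E <= x)%E) ->
  (gbar m L N k a <= x)%E.
Proof.
move=> L0 H; apply: ge_ereal_sup => _ [g [gL gN] <-].
apply: (H (fun i => hderiven i g)) => //.
apply: sub_jet (FcalL_jet L0 gL) => t; rewrite /= in_itv/= => /andP[t0 _].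
exact/halflineP.
Qed.

(** The final stretch of length [a] of a jet on [[0, b]], moved to [[0, a]], competes at [a] with
    the same final value. *)
Lemma gbar_nonincreasing m k (L N a b : R) : 0 <= L -> (k <= m)%N ->
  0 <= a -> a <= b -> (gbar m L N k b <= gbar m L N k a)%E.
Proof.
move=> L0 km a0 ab; apply: gbar_le => // F FJ FN.
have inc t : 0 <= t <= a -> 0 <= t <= b.
  by move=> /andP[-> ta]; rewrite (le_trans ta ab).
(* Reflecting in [[0, b]], restricting to [[0, a]] and reflecting again is a shift by [b - a]; the
   signs cancel. *)
have FJ' : jet `[0, a] m L (fun i t => (-1) ^+ i * F i (b - t)).
  by apply: sub_jet (jet_reflect FJ) => t; rewrite /= !in_itv; exact: inc.
have -> : F k b = (-1) ^+ k * ((-1) ^+ k * F k (b - (a - a))).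
  by rewrite mulrA -exprMn mulrNN mulr1 expr1n mul1r !subrr subr0.
apply: (gbar_ge a0 L0 km (jet_reflect FJ')) => t /andP[t0 ta].
rewrite !expr0 !mul1r FN//; apply/andP; split; lra.
Qed.

Lemma gbar_cvg m k (L N : R) : 0 <= L -> (k <= m)%N ->
  exists2 l : \bar R, gbar m L N k a @[a --> +oo%R] --> l &
    forall a, 0 <= a -> (l <= gbar m L N k a)%E.
Proof.
(* Freezing [gbar] at negative times makes it monotone on the whole line and changes nothing near
   infinity, so the limit is the infimum. *)
move=> L0 km; pose h (a : R) := gbar m L N k (Num.max 0 a).
exists (ereal_inf (range h)); last first.
  by move=> a a0; apply: ereal_inf_lbound; exists a => //; rewrite /h max_r.
have hcvg : h a @[a --> +oo%R] --> ereal_inf (range h).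
  apply: nonincreasing_cvge => a b ab; apply: gbar_nonincreasing => //.
    by rewrite le_max lexx.
  by rewrite ge_max !le_max lexx ab/= orbT.
apply: cvg_trans hcvg; apply: near_eq_cvg.
by near=> a; rewrite /h max_r.
Unshelve. all: by end_near. Qed.

(** The reversals of [F] and of [-F] both compete at [a], with opposite final values; one of these
    is the absolute value, whatever the parity of [k]. *)
Lemma jet_initial_bound m k (L N a : R) F : 0 <= a -> 0 <= L -> (k <= m)%N ->
  jet `[0, a] m L F -> (forall t, 0 <= t <= a -> `|F 0%N t| <= N) ->
  (`|F k 0|%:E <= gbar m L N k a)%E.
Proof.
move=> a0 L0 km FJ FN.
have rev G : jet `[0, a] m L G -> (forall t, 0 <= t <= a -> `|G 0%N t| <= N) ->
    (((-1) ^+ k * G k 0)%:E <= gbar m L N k a)%E.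
  move=> GJ GN; have := gbar_ge a0 L0 km (jet_reflect GJ); rewrite subrr; apply.
  move=> t /andP[t0 ta]; rewrite expr0 mul1r GN//; apply/andP; split; lra.
have := rev _ FJ FN.
have : (((-1) ^+ k * (-1 * F k 0))%:E <= gbar m L N k a)%E.
  apply: (rev (fun i t => -1 * F i t)).
    by have := jetZ (-1) FJ; rewrite normrN1 mul1r.
  by move=> t ta; rewrite mulN1r normrN FN.
have -> : `|F k 0| = `|(-1) ^+ k * F k 0|.
  by rewrite normrM normrX normrN1 expr1n mul1r.
rewrite mulN1r mulrN; case: (ler0P ((-1) ^+ k * F k 0)) => _ //.
Qed.

Lemma worst_case_error0_eq m (D : differentiator R m) (S : set (signal R)) i
    (t tau : R) h : S h -> worst_case_error D S 0 i t = 0%E ->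
  t <= tau -> D h tau ord0 i = hderiven i.+1 h tau.
Proof.
move=> Sh err0 ttau; apply/eqP; rewrite eq_sym -subr_eq0 -normr_le0 -lee_fin.
rewrite (_ : 0%:E = worst_case_error D S 0 i t)//.
apply: (@le_trans _ _ (ereal_sup [set (`|hderiven i.+1 h tau
   - D (h \+ (fun=> 0)) tau ord0 i|)%:E | tau in `[t, +oo[%classic])); last first.
  apply: ereal_sup_ubound; exists (h, fun=> 0) => //=; split => //= s s0.
  by rewrite normr0.
apply: ereal_sup_ubound; exists tau; first by rewrite /= in_itv/= ttau.
by have -> : h \+ (fun=> 0) = h by apply/funext => s /=; rewrite addr0.
Qed.

(** The indistinguishability argument at one time [tau]. Exactness enters only as the correct answer
    of [D] on [(c - 1) G] at [tau], so both notions of exactness can be plugged in. *)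
Lemma worst_case_error_ge m (D : differentiator R m) (S : set (signal R))
    (k : 'I_m) (M N K c t tau : R) G : causal D -> 0 <= M -> 0 <= N ->
  S `<=` FcalL m K -> 0 <= K ->
  jet halfline m (K + M) G -> (forall s, 0 <= s <= tau -> `|G 0%N s| <= N) ->
  S (fun s => c * G 0%N s) ->
  FcalL m M (fun s => (c - 1) * G 0%N s) ->
  D (fun s => (c - 1) * G 0%N s) tau ord0 k =
    hderiven k.+1 (fun s => (c - 1) * G 0%N s) tau ->
  0 <= t -> t <= tau ->
  ((G k.+1 tau)%:E <= worst_case_error D S N k t)%E.
Proof.
move=> cD M0 N0 SK K0 GJ GN Sf hM Dh t0 ttau.
have tau0 := le_trans t0 ttau.
pose f s := c * G 0%N s; pose h s := (c - 1) * G 0%N s.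
(* [G] is bounded by [N] only up to [tau], so the noise is switched off afterwards; causality hides
   this from [D] at [tau]. *)
pose eta s := if s <= tau then - G 0%N s else 0.
have etaN : Ecal N eta.
  move=> s s0; rewrite /eta; case: ifPn => st; last by rewrite normr0.
  by rewrite normrN GN// s0.
have Du : D (f \+ eta) tau = D h tau.
  apply: cD => //.
  - by exists m, K, N, f, eta; split => //; exact: SK.
  - exists m, M, 0, h, (fun=> 0); split => //.
      by move=> s _; rewrite normr0.
    by move=> s _; rewrite addr0.
  - by move=> s /andP[_ st]; rewrite /f /eta /h /= st; ring.
have deriv b : hderiven k.+1 (fun s => b * G 0%N s) tau = b * G k.+1 tau.
  by rewrite (jet_hderiven (jetZ b GJ)).
apply: (@le_trans _ _ (ereal_sup [set (`|hderiven k.+1 f tau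
   - D (f \+ eta) tau ord0 k|)%:E | tau in `[t, +oo[%classic])); last first.
  by apply: ereal_sup_ubound; exists (f, eta).
apply: (@le_trans _ _ (`|hderiven k.+1 f tau - D (f \+ eta) tau ord0 k|%:E)); last first.
  by apply: ereal_sup_ubound; exists tau => //; rewrite /= in_itv/= ttau.
rewrite lee_fin Du Dh !deriv.
have -> : c * G k.+1 tau - (c - 1) * G k.+1 tau = G k.+1 tau by ring.
exact: ler_norm.
Qed.

(** The ratio [L / (L + M)] works unless [L + M = 0]. That [c] is at most 1 in absolute value keeps
    the initial values of [c g] within those allowed in b). *)
Lemma split_bound (L M : R) : 0 <= L -> 0 <= M ->
  exists c : R, [/\ `|c| * (L + M) = L, `|c - 1| * (L + M) = M & `|c| <= 1].
Proof.
move=> L0 M0; have := addr_ge0 L0 M0; rewrite le_eqVlt => /predU1P[S0|S0].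
  have [L00 M00] : L = 0 /\ M = 0 by split; lra.
  by exists 1; rewrite L00 M00 addr0 !mulr0 normr1.
exists (L / (L + M)).
have -> : L / (L + M) - 1 = - (M / (L + M)) by field; rewrite gt_eqF.
rewrite normrN !ger0_norm ?divr_ge0 ?(ltW S0)// !divfK ?gt_eqF//.
by rewrite ler_pdivrMr// mul1r lerDl.
Qed.

Lemma FcalLR_sub m (L : R) (r : 'rV[R]_m.+1) : FcalLR L r `<=` FcalL m L.
Proof. by move=> f []. Qed.

(** The common core of b) and c), which differ in the class [S] only: exactness holds at [t] itself,
    without a transient. *)
Lemma gbar_le_error_from_beginning m (D : differentiator R m) (k : 'I_m)
    (L M N t : R) (S : set (signal R)) : causal D -> 0 <= L -> 0 <= M -> 0 <= N ->
  0 < t -> exact_from_beginning D M -> S `<=` FcalL m L ->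
  (forall c G, `|c| <= 1 -> jet `[0, t] m (L + M) G ->
    (forall s, 0 <= s <= t -> `|G 0%N s| <= N) -> FcalL m L (fun s => c * G 0%N s) ->
    (forall i, (i <= m)%N -> hderiven i (fun s => c * G 0%N s) 0 = c * G i 0) ->
    S (fun s => c * G 0%N s)) ->
  (gbar m (L + M) N k.+1 t <= worst_case_error D S N k t)%E.
Proof.
move=> cD L0 M0 N0 t0 exD SL HS; have LM0 := addr_ge0 L0 M0.
apply: gbar_le => // F FJ FN.
have [c [cL cM c1]] := split_bound L0 M0.
have [G GJ GF] := jet_extend (ltW t0) LM0 FJ.
have GN s : 0 <= s <= t -> `|G 0%N s| <= N by move=> st; rewrite GF// FN.
have hM : FcalL m M (fun s => (c - 1) * G 0%N s).
  by have := jet_FcalL (jetZ (c - 1) GJ); rewrite cM.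
have tt : 0 <= t <= t by rewrite lexx ltW.
rewrite -GF//; apply: (@worst_case_error_ge _ _ _ _ M N L c) => //; last exact: ltW.
- apply: HS => //.
  + apply: sub_jet GJ => s; rewrite /= in_itv/= => /andP[s0 _]; exact/halflineP.
  + by have := jet_FcalL (jetZ c GJ); rewrite cL.
  + by move=> i im; rewrite (jet_hderiven (jetZ c GJ)).
- exact: (worst_case_error0_eq hM (exD t k t0)).
Qed.

Lemma jet0 A m : jet A m (0 : R) (fun _ _ => 0).
Proof.
split.
- by move=> i t _ _; exact: dwithin_cst.
- by move=> s t _ _; rewrite subrr normr0 mul0r.
- by apply: aeW => t _; exists 0; exact: dwithin_cst.
Qed.

End WorstCase.

(** * The lower bound by the limit of [gbar], and the conclusion *)

(** With Lipschitz constant [0], [jet_derivative_bound] on the full window [[0, a]] leaves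
    [K * N / a ^+ k.+1], which tends to [0]. *)
Lemma gbar0_vanishes (R : realType) m k (N : R) (l : \bar R) : 0 <= N ->
  (k < m)%N -> (forall a, 0 <= a -> (l <= gbar m 0 N k.+1 a)%E) -> (l <= 0)%E.
Proof.
move=> N0 km lg; have [K K0 HK] := @jet_derivative_bound R (m - k.+1) k.+1.
rewrite subnKC// in HK.
apply/lee_addgt0Pr => e e0; rewrite add0e.
pose a := Num.max 1 (K * N / e).
have a1 : 1 <= a by rewrite le_max lexx.
have a0 : 0 < a by exact: lt_le_trans a1.
apply: le_trans (lg a (ltW a0)) _; apply: gbar_le => // F FJ FN; rewrite lee_fin.
have := HK 0 F N 0 a a0; rewrite add0r => /(_ FJ FN a).
rewrite lexx (ltW a0) mul0r addr0 => /(_ isT).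
move=> /(le_trans (ler_norm _))/le_trans; apply.
rewrite exprS invfM mulrA ler_pdivrMr ?exprn_gt0//.
apply: (@le_trans _ _ e).
  by rewrite ler_pdivrMr// [leRHS]mulrC -ler_pdivrMr// le_max lexx orbT.
by rewrite ler_peMr ?(ltW e0)// exprn_ege1.
Qed.

Lemma gbar_inf_le_error (R : realType) m (D : differentiator R m) (k : 'I_m)
    (L M N t : R) (r : 'rV[R]_m.+1) (l : \bar R) : causal D ->
  0 <= L -> 0 <= M -> 0 <= N -> 0 <= t -> (forall i, 0 <= r ord0 i) ->
  exact_in_finite_time D M ->
  (forall a, 0 <= a -> (l <= gbar m (L + M) N k.+1 a)%E) ->
  (l <= worst_case_error D (FcalLR L r) N k t)%E.
Proof.
move=> cD L0 M0 N0 t0 r0 exD lg; have LM0 := addr_ge0 L0 M0.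
(* The transient time for zero initial data, fixed before any signal is chosen and independent of
   [r]. *)
have [|t1 t10 ex1] := exD (const_mx 0); first by move=> i; rewrite mxE.
have [c [cL cM c1]] := split_bound L0 M0.
set x := worst_case_error _ _ _ _ _.
(* Signals that are flat at [0] have admissible initial values for every [r], and their multiples
   lie in the class to which [t1] belongs. *)
have flat_le G tau : jet halfline m (L + M) G ->
    (forall s, 0 <= s <= tau -> `|G 0%N s| <= N) ->
    (forall i, (i <= m)%N -> G i 0 = 0) -> t <= tau -> t1 <= tau ->
    ((G k.+1 tau)%:E <= x)%E.
  move=> GJ GN G0 ttau t1tau.
  have hM : @FcalLR R m M (const_mx 0) (fun s => (c - 1) * G 0%N s).
    split; first by have := jet_FcalL (jetZ (c - 1) GJ); rewrite cM.
    move=> i; have im : (i <= m)%N by rewrite -ltnS ltn_ord.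
    by rewrite (jet_hderiven (jetZ (c - 1) GJ))// G0// mulr0 normr0 mxE.
  apply: (@worst_case_error_ge _ _ _ _ _ M N L c) => //.
  - exact: FcalLR_sub.
  - split; first by have := jet_FcalL (jetZ c GJ); rewrite cL.
    move=> i; have im : (i <= m)%N by rewrite -ltnS ltn_ord.
    by rewrite (jet_hderiven (jetZ c GJ))// G0// mulr0 normr0.
  - exact: FcalLR_sub hM.
  - exact: (worst_case_error0_eq hM (ex1 k)).
move: LM0; rewrite le_eqVlt => /predU1P[S0|S0].
  (* If [L + M = 0], the limit is at most [0] and the zero signal already gives a nonnegative
     error. *)
  apply: (@le_trans _ _ 0%E).
    by rewrite -S0 in lg; exact: gbar0_vanishes (ltn_ord k) lg.
  have J0 : jet halfline m (L + M) (fun _ _ => 0) by rewrite -S0; exact: jet0.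
  apply: (flat_le _ (Num.max t t1) J0) => //.
  - by move=> s _; rewrite normr0.
  - by rewrite le_max lexx.
  - by rewrite le_max lexx orbT.
set S := L + M in S0 flat_le lg.
(* Flattening raises the bound to [S + e] and costs at most [e] in the final value; the factor
   [S / (S + e)] restores the bound [S]. *)
have key e : 0 < e -> exists2 a, 0 <= a & forall F, jet `[0, a] m S F ->
    (forall s, 0 <= s <= a -> `|F 0%N s| <= N) ->
    ((S / (S + e) * (F k.+1 a - e))%:E <= x)%E.
  move=> e0; have Se0 : 0 < S + e by rewrite addr_gt0.
  have q0 : 0 <= S / (S + e) by rewrite divr_ge0// ltW.
  have [a0 a01 Ha] := jet_flatten m (ltW S0) N0 m.+1 e0.
  pose a := Num.max a0 (Num.max t t1).
  have aa0 : a0 <= a by rewrite le_max lexx.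
  have a_ge0 : 0 <= a by rewrite (le_trans _ aa0)// (le_trans ler01).
  exists a => // F FJ FN; have [G [GJ GN G0 GF]] := Ha a F aa0 FJ FN.
  have := jetZ (S / (S + e)) GJ; rewrite ger0_norm// divfK ?gt_eqF// => qJ.
  have [H HJ HG] := jet_extend a_ge0 (ltW S0) qJ.
  have Hbound s : 0 <= s <= a -> `|H 0%N s| <= N.
    move=> sa; rewrite HG// normrM ger0_norm// (le_trans _ (GN s sa))//.
    by rewrite ler_piMl// ler_pdivrMr// mul1r lerDl ltW.
  have := flat_le H a HJ Hbound.
  rewrite HG ?a_ge0 ?lexx// => Hle.
  apply: le_trans (Hle _ _ _).
  - rewrite lee_fin ler_wpM2l// lerBlDl -lerBlDr.
    by rewrite (le_trans _ (GF k.+1 _))// distrC ler_norm.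
  - by move=> i im; rewrite HG ?lexx// G0// mulr0.
  - by rewrite !le_max lexx orbT.
  - by rewrite !le_max lexx !orbT.
(* An infinite error is trivial; the value [-oo] is incompatible with [key], whose left side is
   finite. *)
case: x {flat_le} key => [x key| _|key]; last 2 first.
- exact: leey.
- have [a a0 Ha] := key 1 ltr01; apply: le_trans (lg a a0) _.
  apply: gbar_le => [|F FJ FN]; first exact: ltW.
  by have := Ha F FJ FN; rewrite leeNy_eq.
apply/lee_addgt0Pr => e e0; rewrite -EFinD.
have C0 : 0 < `|x| / S + 1 by rewrite ltr_wpDl// divr_ge0// ltW.
(* Solving the estimate of [key] for [F k.+1 a] gives [x + (x / S + 1) * e'], which this choice
   keeps below [x + e]. *)
pose e' := e / (`|x| / S + 1).
have e'0 : 0 < e' by rewrite divr_gt0.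
have [a a0 Ha] := key _ e'0; apply: le_trans (lg a a0) _.
apply: gbar_le => [|F FJ FN]; first exact: ltW.
have := Ha F FJ FN; rewrite !lee_fin.
have Se0 : 0 < S + e' by rewrite addr_gt0.
rewrite mulrAC ler_pdivrMr// mulrC -ler_pdivlMr// lerBlDr => /le_trans; apply.
have -> : x * (S + e') / S + e' = x + (x / S + 1) * e' by field; rewrite gt_eqF.
rewrite lerD2l (@le_trans _ _ ((`|x| / S + 1) * e'))//.
  rewrite ler_wpM2r ?(ltW e'0)// lerD2r ler_wpM2r ?invr_ge0 ?(ltW S0)//.
  exact: ler_norm.
by rewrite /e' mulrC divfK// gt_eqF.
Qed.

(* [k : 'I_m] is counted from 0, so [k.+1] ranges over 1, ..., m. *)
Theorem proposition4p8 (R : realType) (L M N T : R)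
    (hL : 0 <= L) (hM : 0 <= M) (hN : 0 <= N) (hT : 0 < T)
    (m : nat) (k : 'I_m) (D : differentiator R m)
    (hcausal : causal D) (hfinite : exact_in_finite_time D M) :
  (cvg (gbar m (L + M) N k.+1 tau @[tau --> +oo%R]) /\
   forall (r : 'rV[R]_m.+1) (t : R), (forall i, 0 <= r ord0 i) -> 0 <= t ->
     (lim (gbar m (L + M) N k.+1 tau @[tau --> +oo%R])
        <= worst_case_error D (FcalLR L r) N k t)%E)
  /\
  (exact_from_beginning D M ->
    (forall (theta : R) (r : 'rV[R]_m.+1) (t : R), 0 < theta ->
       (forall i, 0 <= r ord0 i) ->
       N <= r ord0 ord0 ->
       (forall i : 'I_m,
          (gbar m (L + M) N i.+1 theta <= (r ord0 (lift ord0 i))%:E)%E) ->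
       theta <= t ->
       (gbar m (L + M) N k.+1 t <= worst_case_error D (FcalLR L r) N k t)%E)
    /\
    (forall t : R, 0 < t ->
       (gbar m (L + M) N k.+1 t <= worst_case_error D (FcalL m L) N k t)%E)).
Proof.
have hLM := addr_ge0 hL hM.
split.
  have [l gl lg] := gbar_cvg N hLM (ltn_ord k).
  split; first by apply/cvg_ex; exists l.
  move=> r t r0 t0; rewrite (_ : lim _ = l); last exact: cvg_lim.
  exact: gbar_inf_le_error lg.
move=> hbegin; split => [theta r t theta0 r0 Nr gr thetat|t t0]; last first.
  exact: gbar_le_error_from_beginning.
apply: gbar_le_error_from_beginning => //.
- exact: lt_le_trans thetat.
- exact: FcalLR_sub.
- move=> c G c1 GJ GN fL fE; split => // i.
  have inc s : 0 <= s <= theta -> 0 <= s <= t.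
    by move=> /andP[-> sth]; rewrite (le_trans sth thetat).
  have im : (i <= m)%N by rewrite -ltnS ltn_ord.
  rewrite fE// normrM (le_trans (ler_piMl _ c1))//.
  (* Order 0 is bounded by [N] directly; a higher order is bounded by reversing the jet restricted
     to [[0, theta]]. *)
  case: (unliftP ord0 i) im => [j ->|->] im.
    have GJ' : jet `[0, theta] m (L + M) G.
      by apply: sub_jet GJ => s; rewrite /= !in_itv; exact: inc.
    rewrite -lee_fin (le_trans _ (gr j))//.
    apply: (jet_initial_bound (ltW theta0) hLM im GJ') => s /inc; exact: GN.
  apply: le_trans Nr; rewrite /=; apply: GN.
  by rewrite lexx (le_trans (ltW theta0) thetat).
Qed.
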